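(* Let $\alpha\in\mathbb{R}$, $r>0$, $\theta\in\mathbb{R}$ and $E\in\mathbb{R}$. If $E\in\sigma_p(H_{\alpha,r,\theta})$, then: (a) For $\tilde\theta\in\mathbb{R}$: $E\in\sigma_p(H_{\alpha,r,\tilde\theta})$ if and only if $\tilde\theta=\theta+k\pi$ for some $k\in\mathbb{Z}$. (b) One of the following holds: (i) $E\notin\sigma_p(H_{\alpha,\tilde r,\theta})$ for every $\tilde r>0$ with $\tilde r\neq r$; (ii) $E\in\sigma_p(H_{\alpha,\tilde r,\theta})$ for every $\tilde r>0$. (c) One of the following holds: (i) $E\notin\sigma_p(H_{\tilde\alpha,r,\theta})$ for every $\tilde\alpha\in\mathbb{R}$ with $\tilde\alpha\neq\alpha$; (ii) $E\in\sigma_p(H_{\tilde\alpha,r,\theta})$ for every $\tilde\alpha\in\mathbb{R}$.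
   Context: Let $I=[a,b]\subset\mathbb{R}$ be a closed finite interval, $V\in L^1(I)$ real-valued, $p\in(a,b)$ an interior point, and fix $\delta,\gamma\in[0,\pi)$. Put $\tau f:=-f''+Vf$. For $\alpha\in\mathbb{R}$, $r>0$, $\theta\in\mathbb{R}$ let $$A_{\alpha,r,\theta}:=P_\alpha H_rE_\theta,\quad P_\alpha=\begin{pmatrix}1&\alpha\\ 0&1\end{pmatrix},\quad H_r=\begin{pmatrix}r&0\\ 0&1/r\end{pmatrix},\quad E_\theta=\begin{pmatrix}\cos\theta&-\sin\theta\\ \sin\theta&\cos\theta\end{pmatrix}.$$ The operator $H_{\alpha,r,\theta}$ in $L^2(I)$ (not to be confused with the matrix $H_r$) acts as $H_{\alpha,r,\theta}f=\tau f$ on the domain of all $f\in L^2(I)$ such that $f,f'$ are absolutely continuous in $I\setminus\{p\}$ (on compact subintervals of $[a,p)$ and of $(p,b]$), $-f''+Vf\in L^2(I)$, $$\begin{pmatrix} f(p+) \\ f'(p+) \end{pmatrix}=A_{\alpha,r,\theta}\begin{pmatrix} f(p-) \\ f'(p-) \end{pmatrix},$$ $f(a)\cos\delta+f'(a)\sin\delta=0$ and $f(b)\cos\gamma+f'(b)\sin\gamma=0$. Here $f(p\pm),f'(p\pm)$ denote one-sided limits. This operator is selfadjoint. $\sigma_p$ denotes the set of eigenvalues. The data $I,V,p,\delta,\gamma$ are fixed and only $\alpha,r,\theta$ vary. *)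

(* Defs.v *)
From mathcomp Require Import all_boot all_order all_algebra.
From mathcomp Require Import complex.
From mathcomp Require Import all_classical all_reals all_analysis.
Import Order.TTheory GRing.Theory Num.Theory.
Import numFieldNormedType.Exports.

Set Implicit Arguments.
Unset Strict Implicit.
Unset Printing Implicit Defensive.

Local Open Scope classical_set_scope.
Local Open Scope complex_scope.
Local Open Scope ring_scope.

(* L^2(I) is the complex Hilbert space; its elements are represented by
   functions R -> R[i] of which only the values on I matter. *)

(* [complex.v] puts no topology on R[i], so limits are taken componentwise. *)
Definition ccvg (R : realType) (f : R -> R[i]) (F : set_system R) (l : R[i]) :
    Prop :=
  ((fun x => complex.Re (f x)) @ F --> complex.Re l) /\
  ((fun x => complex.Im (f x)) @ F --> complex.Im l).

(* The derivative is relative to I: at an end point of I it is one-sided, and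
   the values of f outside I play no role. *)
Definition cderiv_in (R : realType) (I : set R) (f : R -> R[i]) (x : R)
    (l : R[i]) : Prop :=
  ccvg (fun y => (f y - f x) / (y - x)%:C) (within I x^') l.

Definition abs_cont (R : realType) (c d : R) (f : R -> R[i]) : Prop :=
  forall eps : R, 0 < eps -> exists2 eta : R, 0 < eta &
    forall (n : nat) (s t : 'I_n -> R),
      (forall i, c <= s i /\ s i <= t i /\ t i <= d) ->
      trivIset [set: 'I_n] (fun i => `]s i, t i[%classic) ->
      \sum_(i < n) (t i - s i) < eta ->
      \sum_(i < n) ComplexField.Normc.normc (f (t i) - f (s i)) < eps.

Definition loc_abs_cont (R : realType) (D : set R) (f : R -> R[i]) : Prop :=
  forall c d : R, c <= d -> `[c, d] `<=` D -> abs_cont c d f.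

Definition L2 (R : realType) (I : set R) (f : R -> R[i]) : Prop :=
  [/\ measurable_fun I (fun x => complex.Re (f x)),
      measurable_fun I (fun x => complex.Im (f x)) &
      (\int[@lebesgue_measure R]_(x in I)
         ((ComplexField.Normc.normc (f x)) ^+ 2)%:E < +oo)%E].

Definition mx2 (K : nzRingType) (x y z w : K) : 'M[K]_2 :=
  \matrix_(i < 2, j < 2) nth 0 (nth [::] [:: [:: x; y]; [:: z; w]] i) j.

Definition col2 (K : nzRingType) (x y : K) : 'cV[K]_2 :=
  \col_(i < 2) nth 0 [:: x; y] i.

Definition Pmx (R : realType) (alpha : R) : 'M[R]_2 := mx2 1 alpha 0 1.
Definition Hmx (R : realType) (r : R) : 'M[R]_2 := mx2 r 0 0 (1 / r).
Definition Emx (R : realType) (theta : R) : 'M[R]_2 :=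
  mx2 (cos theta) (- sin theta) (sin theta) (cos theta).
Definition Amx (R : realType) (alpha r theta : R) : 'M[R]_2 :=
  Pmx alpha *m Hmx r *m Emx theta.

(* [is_tau I V f f' g] : g = - f'' + V f almost everywhere on I, where f' is
   the derivative of f. *)
Definition is_tau (R : realType) (I : set R) (V : R -> R)
    (f f' g : R -> R[i]) : Prop :=
  {ae @lebesgue_measure R, forall x, I x ->
    exists2 f'' : R[i], cderiv_in I f' x f'' & g x = - f'' + (V x)%:C * f x}.

(* The interface condition f(p+), f'(p+) = A (f(p-), f'(p-)); the four
   one-sided limits are required to exist. *)
Definition interface_cond (R : realType) (p : R) (A : 'M[R]_2)
    (f f' : R -> R[i]) : Prop :=
  exists fl fl' fr fr' : R[i],
    [/\ ccvg f p^'- fl, ccvg f' p^'- fl', ccvg f p^'+ fr, ccvg f' p^'+ fr' &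
        col2 fr fr' = map_mx (real_complex R) A *m col2 fl fl'].

Definition boundary_cond (R : realType) (x phi : R) (f f' : R -> R[i]) : Prop :=
  f x * (cos phi)%:C + f' x * (sin phi)%:C = 0.

(* The operator H_{alpha,r,theta} in L^2([a, b]), as its graph: f is the
   piecewise continuous representative of an element of the domain and g any
   representative of its image. *)
Definition Hop (R : realType) (a b p : R) (V : R -> R) (delta gamma : R)
    (alpha r theta : R) (f g : R -> R[i]) : Prop :=
  let I := `[a, b]%classic in
  [/\ L2 I f, L2 I g &
      exists f' : R -> R[i],
        [/\ forall x, (I `\ p) x -> cderiv_in I f x (f' x),
            loc_abs_cont (I `\ p) f /\ loc_abs_cont (I `\ p) f',
            is_tau I V f f' g,
            interface_cond p (Amx alpha r theta) f f' &
            boundary_cond a delta f f' /\ boundary_cond b gamma f f']].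

(* The set of eigenvalues of an operator in L^2(I) given by its graph. *)
Definition sigma_p (R : realType) (I : set R)
    (T : (R -> R[i]) -> (R -> R[i]) -> Prop) : set R[i] :=
  [set z | exists2 f : R -> R[i],
     ~ {ae @lebesgue_measure R, forall x, I x -> f x = 0} &
     T f (fun x => z * f x)].

Definition sigma_pH (R : realType) (a b p : R) (V : R -> R) (delta gamma : R)
    (alpha r theta : R) : set R[i] :=
  sigma_p `[a, b] (Hop a b p V delta gamma alpha r theta).

(* Main.v *)
Require Import Defs.
From mathcomp Require Import all_boot all_order all_algebra.
From mathcomp Require Import complex ring lra.
From mathcomp Require Import all_classical all_reals all_analysis.
From mathcomp Require Import measurable_realfun.
Import Order.TTheory GRing.Theory Num.Theory.
Import numFieldNormedType.Exports.

Set Implicit Arguments.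
Unset Strict Implicit.
Unset Printing Implicit Defensive.

Local Open Scope classical_set_scope.
Local Open Scope complex_scope.
Local Open Scope ring_scope.

(** An eigenfunction solves [u'' = (V - E) u] on either side of [p], and its
    real and imaginary parts do so too, with the same boundary conditions and
    the same interface condition, because all the data are real. Hence [E] is
    an eigenvalue exactly when there is a real eigenfunction.

    On [[a, p)] the boundary condition at [a] leaves, up to a factor, only one
    solution: the Wronskian of two of them is constant and vanishes at [a].
    The vector [(l, l')] of the limits of [u] and [u'] at [p] from the left is
    therefore determined by [E] up to a factor, and so is, likewise, the vector
    [(r, r')] of the limits from the right. Neither of them is zero, by
    uniqueness for the initial value problem at [p] and because the interface
    matrix is injective. Since the two sides may be rescaled independently
    ([real_eigen_jump]), [E] is an eigenvalue for the parameters
    [alpha', rho', theta'] if and only if [A_(alpha', rho', theta') (l, l')] is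
    collinear with [A_(alpha, rho, theta) (l, l')] ([sigma_pH_criterion]).
    Starting from one eigenfunction, no existence theorem for the differential
    equation is needed.

    With [(w1, w2) = E_theta (l, l')], the determinant of these two vectors is
    a nonzero multiple of [sin (theta' - theta)] when only [theta] varies, of
    [w1 w2 (rho^2 - rho'^2)] when only [rho] varies, and of
    [(alpha - alpha') w2^2] when only [alpha] varies. This is the dichotomy.

    Derivatives exist only almost everywhere, so the analysis rests on
    [ac_derive_ge0]: an absolutely continuous function whose derivative is
    nonnegative almost everywhere is nondecreasing. Applied to plus and minus
    the Wronskian it shows that the Wronskian is constant. Applied to
    [(u^2 + u'^2) exp (+- G)], where [G] is a primitive of [1 + |V - E|], it
    gives uniqueness at [p], where only one-sided limits are at hand. *)

(** * Absolutely continuous functions *)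

(** Absolute continuity of a real function on [[c, d]]. *)
Definition ac (R : realType) (c d : R) (f : R -> R) : Prop :=
  forall eps : R, 0 < eps -> exists2 eta : R, 0 < eta &
    forall (n : nat) (s t : 'I_n -> R),
      (forall i, c <= s i /\ s i <= t i /\ t i <= d) ->
      trivIset [set: 'I_n] (fun i => `]s i, t i[%classic) ->
      \sum_(i < n) (t i - s i) < eta ->
      \sum_(i < n) `|f (t i) - f (s i)| < eps.

(** Induction along a real interval: a property that passes, near every point
    of [[c, d]], from the points to its left to those to its right passes from
    [c] to [d]. *)
Lemma real_induction (R : realType) (P : R -> Prop) (c d : R) :
  c <= d -> P c ->
  (forall z, c <= z <= d -> exists2 rho : R, 0 < rho &
     forall x y, c <= x <= z -> z <= y <= d -> z - rho < x -> y < z + rho ->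
       P x -> P y) ->
  P d.
Proof.
move=> cd Pc step.
pose S := [set x | c <= x <= d /\ P x].
have Sc : S c by split=> //; rewrite lexx.
have Sub : ubound S d by move=> x [/andP[]].
have supS : has_sup S by split; [exists c|exists d].
set z := sup S.
have cz : c <= z by apply: ub_le_sup => //; exists d.
have zd : z <= d by apply: ge_sup => //; exists c.
have [|rho rho0 stepz] := step z; first by rewrite cz.
have [x [/andP[cx xd] Px] zx] := sup_adherent rho0 supS.
have xz : x <= z by apply: ub_le_sup; [exists d|split=> //; rewrite cx].
have key y : z <= y <= d -> y < z + rho -> P y.
  by move=> zyd yz; apply: (stepz x) => //; rewrite cx.
have [dz|dz] := ltP d (z + rho); first by apply: key; rewrite // zd lexx.
have y_le : z + rho / 2 <= z.
  apply: ub_le_sup; first by exists d.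
  have yd : z + rho / 2 <= d by lra.
  split; first by rewrite yd andbT; lra.
  by apply: key; [rewrite yd andbT; lra|lra].
by exfalso; lra.
Qed.

Lemma sum_itv_le_measure (R : realType) (n : nat) (s t : 'I_n -> R)
    (U : set R) :
  measurable U -> (forall i, s i <= t i) ->
  (forall i, `]s i, t i[ `<=` U) ->
  trivIset [set: 'I_n] (fun i => `]s i, t i[%classic) ->
  ((\sum_(i < n) (t i - s i))%:E <= (@lebesgue_measure R) U)%E.
Proof.
move=> mU st stU tI.
have -> : ((\sum_(i < n) (t i - s i))%:E =
    lebesgue_measure (\big[setU/set0]_(i < n | true) `]s i, t i[%classic))%E.
  rewrite measure_bigsetU_ord//= -sumEFin.
  apply: eq_bigr => i _; rewrite lebesgue_measure_itv/= lte_fin.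
  case: ltP => // ts; congr (_%:E); apply/eqP; rewrite subr_eq0 eq_le ts.
  exact: st.
apply: le_measure; rewrite ?inE//=.
  by apply: bigsetU_measurable => i _.
apply: (big_ind (fun A => A `<=` U)) => // A B AU BU.
by rewrite subUset.
Qed.

Lemma derive_slope_ge (R : realType) (f : R -> R) (z l : R) :
  is_derive z 1 f l -> forall eps : R, 0 < eps ->
  exists2 rho : R, 0 < rho & forall y, `|y - z| < rho ->
    `|f y - f z - l * (y - z)| <= eps * `|y - z|.
Proof.
move=> [dfz <-] eps e0.
have /cvgrPdist_le/(_ _ e0) := dfz.
rewrite /dnbhs near_withinE => /nbhs_ballP[rho /= rho0 H].
exists rho => // y yz.
have [->|yz0] := eqVneq y z; first by rewrite !subrr mulr0 subrr normr0 mulr0.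
have yz1 : y - z != 0 by rewrite subr_eq0.
have := H (y - z); rewrite /ball/= sub0r normrN => /(_ yz yz1).
rewrite /GRing.scale/= mulr1 subrK => h.
rewrite -ler_pdivrMr ?normr_gt0// -normfV -normrM.
by rewrite mulrBl mulfK// distrC [X in `|_ - X|]mulrC.
Qed.

Lemma cvg_slope_is_derive (R : realType) (f : R -> R) (z l : R) :
  (f y - f z) / (y - z) @[y --> z^'] --> l -> is_derive z 1 f l.
Proof.
move=> /cvgrPdist_le H.
suff K : h^-1 *: (f (h *: 1 + z) - f z) @[h --> 0^'] --> l.
  by apply: DeriveDef; [apply/cvg_ex; exists l|exact/cvg_lim].
apply/cvgrPdist_le => e /H.
rewrite /dnbhs !near_withinE => /nbhs_ballP[rho /= rho0 K].
apply/nbhs_ballP; exists rho => //= h; rewrite /ball/= sub0r normrN => hr h0.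
have := K (h + z); rewrite /ball/= opprD addrCA subrr addr0 normrN => /(_ hr).
rewrite /GRing.scale/= mulr1 addrK mulrC; apply.
by rewrite -subr_eq0 addrK.
Qed.

(** By real induction, [f x] is at least [f c - eps * (x - c)], except for the
    increments of [f] across finitely many disjoint intervals that lie in an
    open set [U] of small measure; [U] contains the points at which nothing is
    known about the derivative. Absolute continuity bounds these increments. *)
Lemma ac_derive_ge0 (R : realType) (c d : R) (f : R -> R) :
  c <= d -> ac c d f ->
  {ae @lebesgue_measure R, forall x, c < x < d ->
     exists2 l : R, 0 <= l & is_derive x 1 f l} ->
  f c <= f d.
Proof.
move=> cd acf aef.
suff H eps : 0 < eps -> f c - f d <= eps * (d - c) + eps.
  rewrite -subr_le0; apply/ler_addgt0Pr => e e0; rewrite add0r.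
  have h : 0 < e / (d - c + 1) by apply: divr_gt0 => //; lra.
  apply: le_trans (H _ h) _.
  by rewrite -[X in _ + X]mulr1 -mulrDr divfK//; lra.
move=> e0.
have [eta eta0 Heta] := acf _ e0.
have [N [mN N0 sN]] := aef.
(* The derivative may fail to exist at the end points of the interval: they
   are treated as exceptional points. *)
pose B := N `|` [set c] `|` [set d].
have mB : measurable B by apply: measurableU => //; exact: measurableU.
have B0 : lebesgue_measure B = 0%E.
  apply/negligibleP => //; apply: negligibleU.
    apply: negligibleU; apply/negligibleP => //.
    exact: lebesgue_measure_set1.
  by apply/negligibleP => //; exact: lebesgue_measure_set1.
have [U [oU BU UB]] := lebesgue_regularity_outer mB
  (eq_ind_r (fun z => (z < +oo)%E) (ltry 0) B0) eta0.
have mU : measurable U by exact: open_measurable.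
have Ueta : (lebesgue_measure U < eta%:E)%E.
  apply: le_lt_trans UB.
  have mUB : measurable (U `\` B) by exact: measurableD.
  rewrite -[leRHS]adde0 -B0.
  apply: le_trans (@measureU2 _ _ _ lebesgue_measure _ _ mUB mB) => //.
  apply: le_measure; rewrite ?inE//; first exact: measurableU.
  by move=> x Ux; have [Bx|Bx] := pselect (B x); [right|left].
pose Q (x : R) := exists (n : nat) (s t : nat -> R),
  [/\ forall i, (i < n)%N -> [/\ c <= s i, s i <= t i, t i <= x &
                                 `]s i, t i[ `<=` U],
      forall i j, (i < j)%N -> (j < n)%N -> t i <= s j &
      f c - f x <= eps * (x - c) + \sum_(i < n) `|f (t i) - f (s i)|].
have Qd : Q d.
  apply: (@real_induction _ Q c d) => //.
    exists 0%N, (fun=> c), (fun=> c); split=> //.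
    by rewrite big_ord0 !subrr mulr0 addr0.
  move=> z /andP[cz zd].
  have [Bz|Bz] := pselect (B z).
    have [rho rho0 rhoU] : exists2 rho : R, 0 < rho & ball z rho `<=` U.
      have /nbhs_ballP[rho /= rho0 h] : nbhs z U.
        by apply: open_nbhs_nbhs; split=> //; exact: BU.
      by exists rho.
    exists rho => // x y /andP[cx xz] /andP[zy yd] zx yz [n [s [t [st ord le]]]].
    exists n.+1, (fun i => if (i < n)%N then s i else x),
      (fun i => if (i < n)%N then t i else y); split.
    - move=> i; case: (ltnP i n) => [ni _|ni _].
        have [? ? ? ?] := st i ni; split=> //; lra.
      split=> //; first by lra.
      move=> w /=; rewrite in_itv/= => /andP[xw wy]; apply: rhoU.
      by rewrite /ball/= ltr_norml; apply/andP; split; lra.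
    - move=> i j ij; rewrite ltnS leq_eqVlt => /orP[/eqP jn|jn].
        by subst j; rewrite ij ltnn; have [] := st i ij.
      by rewrite jn (ltn_trans ij jn); exact: ord.
    - rewrite big_ord_recr/= ltnn.
      under eq_bigr do rewrite ltn_ord.
      have h : f x - f y <= `|f y - f x| by rewrite distrC ler_norm.
      have h2 : 0 <= eps * (y - x) by apply: mulr_ge0; lra.
      lra.
  have zd' : c < z < d.
    by rewrite !lt_neqAle cz zd !andbT; apply/andP; split; apply/eqP => zE;
       apply: Bz; [left; right|right].
  have [l l0 dl] : exists2 l : R, 0 <= l & is_derive z 1 f l.
    by apply: contrapT => h; apply: Bz; left; left; apply: sN => /(_ zd').
  have [rho rho0 rhoH] := derive_slope_ge dl e0.
  exists rho => // x y /andP[cx xz] /andP[zy yd] zx yz [n [s [t [st ord le]]]].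
  exists n, s, t; split=> // [i /st[? ? ? ?]|]; first by split=> //; lra.
  have /ler_normlP[h1 _] : `|f y - f z - l * (y - z)| <= eps * (y - z).
    by have := rhoH y; rewrite [`|y - z|]ger0_norm ?subr_ge0//; apply; lra.
  have /ler_normlP[_ h2] : `|f x - f z - l * (x - z)| <= eps * (z - x).
    have := rhoH x; rewrite [`|x - z|]distrC [`|z - x|]ger0_norm ?subr_ge0//.
    by apply; lra.
  have h3 : 0 <= l * (y - z) by apply: mulr_ge0; lra.
  have h4 : 0 <= l * (z - x) by apply: mulr_ge0; lra.
  lra.
have [n [s [t [st ord le]]]] := Qd.
have tI : trivIset [set: 'I_n] (fun i => `]s i, t i[%classic).
  have disj (i j : 'I_n) w : (i < j)%N ->
      ~ (`]s i, t i[%classic w /\ `]s j, t j[%classic w).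
    move=> ij; rewrite /= !in_itv/= => -[/andP[_ wt] /andP[sw _]].
    by have := ord i j ij (ltn_ord j); lra.
  move=> i j _ _ [w [wi wj]]; apply/val_inj/eqP; case: ltngtP => // ij.
    by case: (disj i j w).
  by case: (disj j i w).
have := Heta n (s \o val) (t \o val) _ tI.
rewrite /= => h; apply: le_trans le _; rewrite lerD2l ltW// h//.
  by move=> i; have [? ? ? _] := st i (ltn_ord i); split=> //; split=> //; lra.
rewrite -lte_fin; apply: le_lt_trans Ueta; apply: sum_itv_le_measure => //.
  by move=> i; have [] := st i (ltn_ord i).
by move=> i; have [] := st i (ltn_ord i).
Qed.

(** Absolute continuity passes to any function whose increments are bounded
    by fixed combinations of the increments of two given ones. *)
Lemma ac_le2 (R : realType) (c d M : R) (f g h : R -> R) :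
  (forall x y, c <= x <= d -> c <= y <= d ->
     `|h y - h x| <= M * `|f y - f x| + M * `|g y - g x|) ->
  ac c d f -> ac c d g -> ac c d h.
Proof.
move=> le acf acg e e0.
pose K := `|M| + 1.
have K0 : 0 < K by rewrite ltr_wpDl.
have MK : M <= K by rewrite (le_trans (ler_norm _))// lerDl.
have eK : 0 < e / (2 * K) by apply: divr_gt0 => //; lra.
have [e1 e10 H1] := acf _ eK.
have [e2 e20 H2] := acg _ eK.
exists (Num.min e1 e2); first by rewrite lt_min e10.
move=> n s t st tI; rewrite lt_min => /andP[l1 l2].
have {H1 l1}h1 := H1 n s t st tI l1.
have {H2 l2}h2 := H2 n s t st tI l2.
apply: (@le_lt_trans _ _ (\sum_(i < n)
    (K * `|f (t i) - f (s i)| + K * `|g (t i) - g (s i)|))).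
  apply: ler_sum => i _; have [ci [si ti]] := st i.
  apply: le_trans (le _ _ _ _) _; [lra|lra|].
  by apply: lerD; apply: ler_wpM2r.
rewrite big_split/= -!mulr_sumr -mulrDr -ltr_pdivlMl//.
have -> : K^-1 * e = e / (2 * K) + e / (2 * K) by field; rewrite gt_eqF.
exact: ltrD.
Qed.

Lemma ac_bounded (R : realType) (c d : R) f : c <= d -> ac c d f ->
  exists M, forall x, c <= x <= d -> `|f x| <= M.
Proof.
move=> cd acf.
(* Absolute continuity for one interval is uniform continuity. *)
have [eta eta0 H] := acf 1 ltr01.
have step x y : c <= x -> x <= y -> y <= d -> y - x < eta ->
    `|f y - f x| < 1.
  move=> cx xy yd yx.
  have := H 1%N (fun=> x) (fun=> y); rewrite !big_ord1; apply => //.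
  by move=> i j _ _ _; rewrite !ord1.
apply: (@real_induction _
  (fun z => exists M, forall x, c <= x <= z -> `|f x| <= M) c d) => //.
  exists `|f c| => x /andP[cx xc].
  by have -> : x = c by apply/eqP; rewrite eq_le xc.
move=> z /andP[cz zd]; exists (eta / 2); first lra.
move=> x y /andP[cx xz] /andP[zy yd] zx yz [M HM].
exists (M + 1) => w /andP[cw wy].
have [wx|xw] := leP w x.
  by apply: le_trans (HM w _) _; [rewrite cw|lra].
have h1 : `|f w - f x| < 1 by apply: step; lra.
have h2 : `|f x| <= M by apply: HM; rewrite cx lexx.
have := ler_normD (f w - f x) (f x); rewrite subrK; lra.
Qed.

Lemma acD (R : realType) (c d : R) f g :
  ac c d f -> ac c d g -> ac c d (fun x => f x + g x).
Proof.
apply: (@ac_le2 _ _ _ 1) => x y _ _; rewrite !mul1r.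
by rewrite opprD addrACA ler_normD.
Qed.

Lemma acZ (R : realType) (c d k : R) f : ac c d f -> ac c d (fun x => k * f x).
Proof.
move=> acf; apply: (@ac_le2 _ _ _ `|k| f f) => // x y _ _.
by rewrite -mulrBr normrM lerDl mulr_ge0.
Qed.

Lemma acM (R : realType) (c d : R) f g : c <= d ->
  ac c d f -> ac c d g -> ac c d (fun x => f x * g x).
Proof.
move=> cd acf acg.
have [M1 H1] := ac_bounded cd acf.
have [M2 H2] := ac_bounded cd acg.
apply: (@ac_le2 _ _ _ (Num.max M1 M2) f g) => // x y xcd ycd.
have -> : f y * g y - f x * g x = g y * (f y - f x) + f x * (g y - g x) by ring.
apply: le_trans (ler_normD _ _) _; rewrite !normrM.
apply: lerD; apply: ler_wpM2r => //.
  by apply: le_trans (H2 y ycd) _; rewrite le_max lexx orbT.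
by apply: le_trans (H1 x xcd) _; rewrite le_max lexx.
Qed.

Lemma ac_expR (R : realType) (c d : R) f : c <= d ->
  ac c d f -> ac c d (fun x => expR (f x)).
Proof.
move=> cd acf.
have [M HM] := ac_bounded cd acf.
apply: (@ac_le2 _ _ _ (expR M) f f) => // x y xcd ycd.
have key u v : u <= M -> v <= u -> `|expR u - expR v| <= expR M * `|u - v|.
  move=> uM vu; rewrite !ger0_norm ?subr_ge0 ?ler_expR//.
  have -> : expR u - expR v = expR u * (1 - expR (v - u)).
    by rewrite mulrBr mulr1 -expRD subrKC.
  apply: ler_pM; [exact: expR_ge0|by rewrite subr_ge0 -expR0 ler_expR subr_le0
    |by rewrite ler_expR|by have := expR_ge1Dx (v - u); lra].
have fM w : c <= w <= d -> f w <= M.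
  by move=> wcd; apply: le_trans (HM w wcd); exact: ler_norm.
have h : `|expR (f y) - expR (f x)| <= expR M * `|f y - f x|.
  have [xy|yx] := leP (f x) (f y); first by apply: key => //; exact: fM.
  by rewrite distrC [X in _ * X]distrC; apply: key; [exact: fM|exact: ltW].
by apply: le_trans h _; rewrite lerDl mulr_ge0// expR_ge0.
Qed.

(** The indefinite integral of [k], based at minus infinity. *)
Definition primitive (R : realType) (k : R -> R) (x : R) : R :=
  \int[@lebesgue_measure R]_(y in `]-oo, x]) k y.

Section primitive.
Variables (R : realType) (k : R -> R).
Hypothesis k0 : forall x, 0 <= k x.
Hypothesis intk : (@lebesgue_measure R).-integrable setT (EFin \o k).

Lemma primitiveB (s t : R) : s <= t ->
  primitive k t - primitive k s =
  \int[@lebesgue_measure R]_(y in `]s, t[) k y.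
Proof.
move=> st; rewrite /primitive Rintegral_itvB//; last first.
  exact: integrableS intk.
by rewrite Rintegral_itv_bndo_bndc//; exact: integrableS intk.
Qed.

Lemma primitive_bounded (x : R) :
  0 <= primitive k x <= \int[@lebesgue_measure R]_y k y.
Proof.
rewrite Rintegral_ge0//= /primitive /Rintegral fine_le//.
- by apply: integrable_fin_num => //; exact: integrableS intk.
- exact: integrable_fin_num.
- apply: ge0_subset_integral => //; last by move=> y _; rewrite lee_fin.
  by case/integrableP : intk.
Qed.

Lemma ac_primitive (c d : R) : ac c d (primitive k).
Proof.
move=> e e0.
have [eta [eta0 H]] := integral_normr_continuous intk e0.
exists eta => // n s t st tI sum_eta.
pose D := \big[setU/set0]_(i <- enum 'I_n) `]s i, t i[%classic.
have mD : measurable D by apply: bigsetU_measurable => i _.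
have tI' : trivIset [set` enum 'I_n] (fun i => `]s i, t i[%classic).
  exact: sub_trivIset tI.
have -> : \sum_(i < n) `|primitive k (t i) - primitive k (s i)| =
    \int[@lebesgue_measure R]_(x in D) `|k x|.
  rewrite /Rintegral integral_bigsetU_EFin//; last 2 first.
    exact: enum_uniq.
    apply: measurable_funTS; apply/measurable_EFinP/measurableT_comp => //.
    by apply/measurable_EFinP; case/integrableP : intk.
  have E i : (\int[@lebesgue_measure R]_(x in `]s i, t i[) `|k x|%:E)%E =
      (`|primitive k (t i) - primitive k (s i)|)%:E.
    have [_ [sti _]] := st i.
    rewrite primitiveB// ger0_norm; last by apply: Rintegral_ge0.
    rewrite /Rintegral fineK; last first.
      by apply: integrable_fin_num => //; exact: integrableS intk.
    by apply: eq_integral => x _; rewrite ger0_norm.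
  by rewrite big_enum/= (eq_bigr _ (fun i _ => E i)) sumEFin.
apply: H => //.
apply: le_lt_trans (_ : ((\sum_(i < n) (t i - s i))%:E < eta%:E)%E); last first.
  by rewrite lte_fin.
rewrite /D big_enum/= measure_bigsetU_ord//= -sumEFin lee_sum// => i _.
have [_ [sti _]] := st i.
by rewrite lebesgue_measure_itv/= lte_fin; case: ifPn => // _;
  rewrite lee_fin subr_ge0.
Qed.

Lemma derive_primitive :
  {ae @lebesgue_measure R, forall x : R, is_derive x 1 (primitive k) (k x)}.
Proof.
have loc : locally_integrable setT k.
  by apply: open_integrable_locally intk; exact: openT.
have inty y : (@lebesgue_measure R).-integrable `]-oo, y] (EFin \o k).
  exact: integrableS intk.
have := FTC1Ny inty loc.
apply: filterS; first exact: (ae_filter_ringOfSetsType lebesgue_measure).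
move=> x [dx dxE].
by apply: DeriveDef; [exact: dx|rewrite -derive1E; exact: dxE].
Qed.
End primitive.

(** * The equation [u'' = q u] with an integrable coefficient *)

(** [u] solves [u'' = q u] on [[c, d]] in the sense of Caratheodory, and [u']
    is its derivative. *)
Definition solves (R : realType) (q : R -> R) (c d : R) (u u' : R -> R) : Prop :=
  [/\ ac c d u, ac c d u',
      forall x, c < x < d -> is_derive x 1 u (u' x) &
      {ae @lebesgue_measure R, forall x, c < x < d ->
        is_derive x 1 u' (q x * u x)}].

Lemma is_derive_mul (R : realType) (f g : R -> R) (x a b : R) :
  is_derive x 1 f a -> is_derive x 1 g b ->
  is_derive x 1 (fun y => f y * g y) (f x * b + g x * a).
Proof. by move=> df dg; exact: is_deriveM. Qed.

Lemma is_derive_add (R : realType) (f g : R -> R) (x a b : R) :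
  is_derive x 1 f a -> is_derive x 1 g b ->
  is_derive x 1 (fun y => f y + g y) (a + b).
Proof. by move=> df dg; exact: is_deriveD. Qed.

Lemma is_derive_scale (R : realType) (k : R) (f : R -> R) (x a : R) :
  is_derive x 1 f a -> is_derive x 1 (fun y => k * f y) (k * a).
Proof. by move=> df; exact: is_deriveZ. Qed.

(** The Wronskian of [u] and [v], whose derivatives are [u'] and
    [v']; the difference is written with the factor [-1] to match the closure
    of absolute continuity under sums and scaling. *)
Definition wronskian (R : realType) (u u' v v' : R -> R) (x : R) : R :=
  u x * v' x + -1 * (u' x * v x).

Lemma wronskian_le (R : realType) (q : R -> R) (c d : R) (u u' v v' : R -> R) :
  c <= d -> solves q c d u u' -> solves q c d v v' ->
  wronskian u u' v v' c <= wronskian u u' v v' d.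
Proof.
move=> cd [acu acu' du du'] [acv acv' dv dv'].
apply: ac_derive_ge0 => //.
  by apply: acD; [exact: acM|apply: acZ; exact: acM].
move: du' dv'; apply: filterS2.
  exact: (ae_filter_ringOfSetsType lebesgue_measure).
move=> x /= du' dv' xcd; exists 0 => //.
apply: is_derive_eq.
  apply: is_derive_add.
    by apply: is_derive_mul; [exact: du|exact: dv'].
  by apply/is_derive_scale/is_derive_mul; [exact: du'|exact: dv].
by rewrite /=; ring.
Qed.

Lemma wronskian_const (R : realType) (q : R -> R) (c d : R)
    (u u' v v' : R -> R) :
  c <= d -> solves q c d u u' -> solves q c d v v' ->
  wronskian u u' v v' c = wronskian u u' v v' d.
Proof.
move=> cd su sv; apply/eqP; rewrite eq_le (wronskian_le cd su sv)/=.
have := wronskian_le cd sv su; rewrite /wronskian; lra.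
Qed.

(** The squared length of the vector [(u, u')]. *)
Definition energy (R : realType) (u u' : R -> R) (x : R) : R :=
  u x * u x + u' x * u' x.

(** Since [(u^2 + u'^2)' = 2 (1 + q) u u'], the energy grows and decays at most
    at the rate [k >= 1 + |q|]. *)
Lemma energy_expR_le (R : realType) (q k : R -> R) (c d : R) (u u' : R -> R) :
  c <= d -> solves q c d u u' ->
  (forall x, 0 <= k x) ->
  (@lebesgue_measure R).-integrable setT (EFin \o k) ->
  (forall x, c < x < d -> 1 + `|q x| <= k x) ->
  energy u u' c * expR (primitive k c) <= energy u u' d * expR (primitive k d)
  /\ energy u u' d * expR (- 1 * primitive k d) <=
     energy u u' c * expR (- 1 * primitive k c).
Proof.
move=> cd [acu acu' du du'] k0 intk kq.
have ack := ac_primitive k0 intk.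
have acE : ac c d (energy u u') by apply: acD; exact: acM.
have dk := derive_primitive intk.
have rate x : c < x < d ->
    `|2 * u x * u' x * (1 + q x)| <= k x * energy u u' x.
  move=> xcd.
  have e0 : 0 <= energy u u' x by rewrite addr_ge0// -expr2 sqr_ge0.
  rewrite normrM mulrC; apply: ler_pM => //.
    apply: le_trans (kq x xcd); apply: le_trans (ler_normD _ _) _.
    by rewrite normr1.
  rewrite /energy ler_norml; apply/andP; split.
    have := sqr_ge0 (u x + u' x); rewrite sqrrD !expr2 mulr2n; lra.
  have := sqr_ge0 (u x - u' x); rewrite sqrrB !expr2 mulr2n; lra.
have dE x : c < x < d -> is_derive x 1 u' (q x * u x) ->
    is_derive x 1 (energy u u') (2 * u x * u' x * (1 + q x)).
  move=> /du dux du'x.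
  apply: (is_derive_eq
    (is_derive_add (is_derive_mul dux dux) (is_derive_mul du'x du'x))).
  by rewrite /=; ring.
have dX (x s : R) : is_derive x 1 (primitive k) (k x) ->
    is_derive x 1 (fun y => expR (s * primitive k y))
      (expR (s * primitive k x) * (s * k x)).
  by move=> dkx; apply: is_derive1_comp; exact: is_derive_scale.
split.
- suff : energy u u' c * expR (1 * primitive k c) <=
         energy u u' d * expR (1 * primitive k d) by rewrite !mul1r.
  apply: (@ac_derive_ge0 _ _ _
    (fun x => energy u u' x * expR (1 * primitive k x))) => //.
    by apply: acM => //; apply: ac_expR => //; exact: acZ.
  move: du' dk; apply: filterS2.
    exact: (ae_filter_ringOfSetsType lebesgue_measure).
  move=> x /= du'x dkx xcd; have /ler_normlP[h _] := rate x xcd.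
  exists (expR (1 * primitive k x) *
          (k x * energy u u' x + 2 * u x * u' x * (1 + q x))).
    by rewrite mulr_ge0 ?expR_ge0//; lra.
  apply: (is_derive_eq (is_derive_mul (dE _ xcd (du'x xcd)) (dX _ 1 dkx))).
  by rewrite /=; ring.
- rewrite -[leLHS]opprK -[leRHS]opprK lerN2.
  rewrite -[leLHS]mulN1r -[leRHS]mulN1r.
  apply: (@ac_derive_ge0 _ _ _
    (fun x => -1 * (energy u u' x * expR (-1 * primitive k x)))) => //.
    by apply/acZ/acM => //; apply: ac_expR => //; exact: acZ.
  move: du' dk; apply: filterS2.
    exact: (ae_filter_ringOfSetsType lebesgue_measure).
  move=> x /= du'x dkx xcd; have /ler_normlP[_ h] := rate x xcd.
  exists (expR (-1 * primitive k x) *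
          (k x * energy u u' x - 2 * u x * u' x * (1 + q x))).
    by rewrite mulr_ge0 ?expR_ge0//; lra.
  apply: (is_derive_eq (is_derive_scale (-1)
    (is_derive_mul (dE _ xcd (du'x xcd)) (dX _ (-1) dkx)))).
  by rewrite /=; ring.
Qed.

(** * Real eigenfunctions *)

(** [slope_cvg I f x l]: [l] is the derivative of [f] at [x] relative to [I]. *)
Definition slope_cvg (R : realType) (I : set R) (f : R -> R) (x l : R) : Prop :=
  (f y - f x) / (y - x) @[y --> within I x^'] --> l.

(** Everything that an eigenfunction must satisfy apart from the interface
    condition, for a real-valued function [u] with derivative [u']; [l], [l']
    are the limits of [u], [u'] at [p] from the left and [r], [r'] those from
    the right. *)
Record real_eigen (R : realType) (a b p : R) (V : R -> R) (delta gamma E : R)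
    (u u' : R -> R) (l l' r r' : R) : Prop := RealEigen {
  re_neq0 : ~ {ae @lebesgue_measure R, forall x, `[a, b]%classic x -> u x = 0};
  re_meas : measurable_fun `[a, b] u;
  re_L2 : (\int[@lebesgue_measure R]_(x in `[a, b]) ((u x) ^+ 2)%:E < +oo)%E;
  re_deriv : forall x, (`[a, b] `\ p) x -> slope_cvg `[a, b] u x (u' x);
  re_ac : forall c d, c <= d -> `[c, d] `<=` `[a, b] `\ p ->
    ac c d u /\ ac c d u';
  re_eq : {ae @lebesgue_measure R, forall x, `[a, b]%classic x ->
    exists2 u'', slope_cvg `[a, b] u' x u'' & E * u x = - u'' + V x * u x};
  re_lim_l : u @ p^'- --> l;
  re_lim_l' : u' @ p^'- --> l';
  re_lim_r : u @ p^'+ --> r;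
  re_lim_r' : u' @ p^'+ --> r';
  re_bc_a : u a * cos delta + u' a * sin delta = 0;
  re_bc_b : u b * cos gamma + u' b * sin gamma = 0 }.

Lemma slope_cvg_is_derive (R : realType) (a b : R) (f : R -> R) (x l : R) :
  a < x < b -> slope_cvg `[a, b] f x l -> is_derive x 1 f l.
Proof.
move=> xab H; apply: cvg_slope_is_derive; apply: cvg_trans H.
apply: cvg_app => A wA.
have {}wA : \forall y \near x^', `[a, b]%classic y -> A y by exact: wA.
have abx : \forall y \near x^', `[a, b]%classic y.
  apply: nbhs_dnbhs; have /near_in_itvoo : x \in `]a, b[ by rewrite in_itv/=.
  by apply: filterS => y /=; rewrite !in_itv/=; lra.
suff : \forall y \near x^', A y by [].
by apply: filterS2 wA abx => y; apply.
Qed.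

Lemma real_eigen_solves (R : realType) (a b p : R) (V : R -> R)
    (delta gamma E : R) (u u' : R -> R) (l l' r r' c d : R) :
  real_eigen a b p V delta gamma E u u' l l' r r' ->
  c <= d -> `[c, d] `<=` `[a, b] `\ p ->
  solves (fun x => V x - E) c d u u'.
Proof.
move=> re cd cdab; have [acu acu'] := re_ac re cd cdab.
have ab : a <= c /\ d <= b.
  have /cdab[+ _] : `[c, d]%classic c by rewrite /= in_itv/= lexx.
  have /cdab[+ _] : `[c, d]%classic d by rewrite /= in_itv/= lexx andbT.
  by rewrite /= !in_itv/= => /andP[_ ->] /andP[->].
have inab x : c < x < d -> a < x < b by lra.
split=> // [x xcd|].
  apply: (slope_cvg_is_derive (inab x xcd)); apply: (re_deriv re).
  by apply: cdab; rewrite /= in_itv/= !ltW//; lra.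
have := re_eq re; apply: filterS.
  exact: (ae_filter_ringOfSetsType lebesgue_measure).
move=> x H xcd; have := inab x xcd => xab.
have [|u'' du' eqx] := H; first by rewrite /= in_itv/=; lra.
have -> : (V x - E) * u x = u'' by rewrite mulrBl eqx; ring.
exact: slope_cvg_is_derive du'.
Qed.

Lemma itv_left (R : realType) (a b p d : R) : p < b -> d < p ->
  `[a, d] `<=` `[a, b] `\ p.
Proof.
move=> pb dp x /=; rewrite !in_itv/= => /andP[ax xd]; split; first lra.
by move=> xp; lra.
Qed.

Lemma itv_right (R : realType) (a b p d : R) : a < p -> p < d ->
  `[d, b] `<=` `[a, b] `\ p.
Proof.
move=> pb dp x /=; rewrite !in_itv/= => /andP[ax xd]; split; first lra.
by move=> xp; lra.
Qed.

Section real_eigen_theory.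
Variables (R : realType) (a b p : R) (V : R -> R) (delta gamma E : R).
Hypothesis hp : a < p < b.
Hypothesis hV : (@lebesgue_measure R).-integrable `[a, b] (EFin \o V).

Let ap : a < p. Proof. by case/andP: hp. Qed.
Let pb : p < b. Proof. by case/andP: hp. Qed.

(** An integrable majorant of [1 + |V - E|]. *)
Let rate (x : R) : R := ((fun x => 1 + `|V x - E|) \_ `[a, b]) x.

Let rate_ge0 x : 0 <= rate x.
Proof. by rewrite /rate patchE; case: ifP => // _; rewrite addr_ge0. Qed.

Let rateE x : a < x < b -> 1 + `|V x - E| <= rate x.
Proof. by move=> xab; rewrite /rate patchE mem_set//= in_itv/=; lra. Qed.

Let int_rate : (@lebesgue_measure R).-integrable setT (EFin \o rate).
Proof.
have -> : EFin \o rate = (EFin \o (fun x => 1 + `|V x - E|)) \_ `[a, b].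
  by apply/funext => x; rewrite /rate /= !patchE; case: ifP.
apply/(integrable_mkcond _ _).1 => //.
have fin (z : R) : (@lebesgue_measure R).-integrable `[a, b] (EFin \o cst z).
  apply: measurable_bounded_integrable => //.
    by rewrite /= lebesgue_measure_itv/=; case: ifP => _; rewrite ?ltry.
  exact: bounded_cst.
have intVE : (@lebesgue_measure R).-integrable `[a, b]
    ((EFin \o V) \- (EFin \o cst E))%E by exact: integrableB.
have int1 : (@lebesgue_measure R).-integrable `[a, b]
    ((EFin \o cst (1%R : R)) \+ (abse \o ((EFin \o V) \- (EFin \o cst E))%E))%E.
  by apply: integrableD => //; exact: integrable_abse.
exact: int1.
Qed.

Variables (u u' : R -> R) (l l' r r' : R).
Hypothesis re : real_eigen a b p V delta gamma E u u' l l' r r'.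

Lemma energy_eq0 (v v' : R -> R) x : energy v v' x <= 0 -> v x = 0.
Proof.
move=> e0; have h1 := sqr_ge0 (v x); have h2 := sqr_ge0 (v' x).
apply/eqP; rewrite -sqrf_eq0 eq_le h1 andbT.
by move: e0; rewrite /energy -!expr2; lra.
Qed.

(** [energy u u' * exp G] is nondecreasing to the left of [p] and tends to [0]
    at [p], so it vanishes. *)
Lemma real_eigen_left_eq0 x : l = 0 -> l' = 0 -> a <= x < p -> u x = 0.
Proof.
move=> l0 l'0 /andP[ax xp]; apply: (@energy_eq0 u u').
pose K := \int[@lebesgue_measure R]_y rate y.
have lim : (energy u u' y * expR K) @[y --> p^'-] --> 0.
  have -> : 0 = (l * l + l' * l') * expR K by rewrite l0 l'0; ring.
  apply: cvgMr_tmp; apply: cvgD; apply: cvgM;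
    first [exact: re_lim_l re|exact: re_lim_l' re].
have ex : energy u u' x * expR (primitive rate x) <= 0.
  apply: (cvgr_to_ge lim); near=> y.
  have xy : x < y by near: y; exact: nbhs_left_gt.
  have yp : y < p by near: y; exact: nbhs_left_lt.
  have sol : solves (fun x => V x - E) x y u u'.
    apply: (real_eigen_solves re); first exact: ltW.
    by apply: subset_trans (itv_left pb yp); apply: subset_itvr; rewrite bnd_simp.
  have rxy z : x < z < y -> 1 + `|V z - E| <= rate z.
    move=> /andP[xz zy]; apply: rateE.
    by rewrite (le_lt_trans ax xz)/= (lt_trans zy)// (lt_trans yp).
  have [h _] := energy_expR_le (ltW xy) sol rate_ge0 int_rate rxy.
  apply: le_trans h _; apply: ler_wpM2l.
    by rewrite /energy addr_ge0// -expr2 sqr_ge0.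
  by rewrite ler_expR; have /andP[] := primitive_bounded rate_ge0 int_rate y.
by move: ex; rewrite pmulr_lle0// expR_gt0.
Unshelve. all: by end_near. Qed.

(** [energy u u' * exp (- G)] is nonincreasing to the right of [p] and tends to
    [0] at [p], so it vanishes. *)
Lemma real_eigen_right_eq0 x : r = 0 -> r' = 0 -> p < x <= b -> u x = 0.
Proof.
move=> r0 r'0 /andP[px xb]; apply: (@energy_eq0 u u').
have lim : energy u u' y @[y --> p^'+] --> 0.
  have -> : 0 = r * r + r' * r' by rewrite r0 r'0; ring.
  apply: cvgD; apply: cvgM; first [exact: re_lim_r re|exact: re_lim_r' re].
have ex : energy u u' x * expR (-1 * primitive rate x) <= 0.
  apply: (cvgr_to_ge lim); near=> y.
  have yx : y < x by near: y; exact: nbhs_right_lt.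
  have py : p < y by near: y; exact: nbhs_right_gt.
  have sol : solves (fun x => V x - E) y x u u'.
    apply: (real_eigen_solves re); first exact: ltW.
    by apply: subset_trans (itv_right ap py); apply: subset_itvl; rewrite bnd_simp.
  have ryx z : y < z < x -> 1 + `|V z - E| <= rate z.
    move=> /andP[yz zx]; apply: rateE.
    by rewrite (lt_le_trans zx xb) (lt_trans _ yz)// (lt_trans ap).
  have [_ h] := energy_expR_le (ltW yx) sol rate_ge0 int_rate ryx.
  apply: le_trans h _; rewrite -[leRHS]mulr1; apply: ler_wpM2l.
    by rewrite /energy addr_ge0// -expr2 sqr_ge0.
  rewrite -[leRHS]expR0 ler_expR mulN1r oppr_le0.
  by have /andP[] := primitive_bounded rate_ge0 int_rate y.
by move: ex; rewrite pmulr_lle0// expR_gt0.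
Unshelve. all: by end_near. Qed.

(** Uniqueness for the initial value problem at [p], on both sides: an
    eigenfunction does not have all its one-sided limits equal to zero. *)
Lemma real_eigen_lim_neq0 :
  ~ [/\ l = 0, l' = 0, r = 0 & r' = 0].
Proof.
move=> [l0 l'0 r0 r'0]; apply: (re_neq0 re).
exists [set p]; split => //; first exact: lebesgue_measure_set1.
move=> x /= nx; apply: contrapT => xp; apply: nx; rewrite /= in_itv/= => xab.
have [px|xp'|px] := ltgtP p x; last by case: xp; rewrite /= px.
  by apply: real_eigen_right_eq0 => //; lra.
by apply: real_eigen_left_eq0 => //; lra.
Qed.

Variables (v v' : R -> R) (m m' s s' : R).
Hypothesis rv : real_eigen a b p V delta gamma E v v' m m' s s'.

(** Two pairs of boundary values that satisfy the same boundary condition are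
    collinear. *)
Lemma bc_wronskian (phi x y x' y' : R) :
  x * cos phi + y * sin phi = 0 -> x' * cos phi + y' * sin phi = 0 ->
  x * y' = y * x'.
Proof.
move=> h h'; have cs := cos2Dsin2 phi.
have e1 : (x * y' - y * x') * cos phi = 0.
  have -> : (x * y' - y * x') * cos phi = (x * cos phi + y * sin phi) * y' -
    (x' * cos phi + y' * sin phi) * y by ring.
  by rewrite h h' !mul0r subrr.
have e2 : (x * y' - y * x') * sin phi = 0.
  have -> : (x * y' - y * x') * sin phi = (x' * cos phi + y' * sin phi) * x -
    (x * cos phi + y * sin phi) * x' by ring.
  by rewrite h h' !mul0r subrr.
apply/eqP; rewrite -subr_eq0 -[X in X == _]mulr1 -cs !expr2 mulrDr !mulrA.
by rewrite e1 e2 !mul0r addr0.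
Qed.

(** The Wronskian of two eigenfunctions is constant on either side of [p] and
    vanishes at [a] and [b] by the boundary conditions, hence it tends to [0] at
    [p] from the left and from the right. *)
Lemma real_eigen_wronskian_left : l * m' = l' * m.
Proof.
have lim : wronskian u u' v v' y @[y --> p^'-] --> l * m' + -1 * (l' * m).
  apply: cvgD; first by apply: cvgM; [exact: re_lim_l re|exact: re_lim_l' rv].
  by apply: cvgMl_tmp; apply: cvgM;
    [exact: re_lim_l' re|exact: re_lim_l rv].
have lim0 : wronskian u u' v v' y @[y --> p^'-] --> 0.
  apply: cvg_near_cst.
  near=> y.
  have ay : a < y by near: y; exact: nbhs_left_gt.
  have yp : y < p by near: y; exact: nbhs_left_lt.
  have su := real_eigen_solves re (ltW ay) (itv_left pb yp).
  have sv := real_eigen_solves rv (ltW ay) (itv_left pb yp).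
  rewrite -(wronskian_const (ltW ay) su sv) /wronskian.
  by rewrite (bc_wronskian (re_bc_a re) (re_bc_a rv)) mulN1r subrr.
have := cvg_unique _ lim lim0; rewrite mulN1r => h; apply/eqP; rewrite -subr_eq0 h//.
Unshelve. all: by end_near. Qed.

Lemma real_eigen_wronskian_right : r * s' = r' * s.
Proof.
have lim : wronskian u u' v v' y @[y --> p^'+] --> r * s' + -1 * (r' * s).
  apply: cvgD; first by apply: cvgM; [exact: re_lim_r re|exact: re_lim_r' rv].
  by apply: cvgMl_tmp; apply: cvgM;
    [exact: re_lim_r' re|exact: re_lim_r rv].
have lim0 : wronskian u u' v v' y @[y --> p^'+] --> 0.
  apply: cvg_near_cst.
  near=> y.
  have yb : y < b by near: y; exact: nbhs_right_lt.
  have py : p < y by near: y; exact: nbhs_right_gt.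
  have su := real_eigen_solves re (ltW yb) (itv_right ap py).
  have sv := real_eigen_solves rv (ltW yb) (itv_right ap py).
  rewrite (wronskian_const (ltW yb) su sv) /wronskian.
  by rewrite (bc_wronskian (re_bc_b re) (re_bc_b rv)) mulN1r subrr.
have := cvg_unique _ lim lim0; rewrite mulN1r => h; apply/eqP; rewrite -subr_eq0 h//.
Unshelve. all: by end_near. Qed.

End real_eigen_theory.

(** * Real and imaginary parts of eigenfunctions *)

(** The properties that the real part and the imaginary part have in common. *)
Record part (R : realType) (P : R[i] -> R) : Prop := Part {
  partD : forall z w, P (z + w) = P z + P w;
  partN : forall z, P (- z) = - P z;
  partM : forall z x, P (z * x%:C) = P z * x;
  part_le : forall z, `|P z| <= ComplexField.Normc.normc z;
  part_ccvg : forall (f : R -> R[i]) F l, ccvg f F l -> P \o f @ F --> P l;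
  part_L2 : forall (I : set R) f, L2 I f -> measurable_fun I (P \o f) }.

Lemma part_Re (R : realType) : part (@complex.Re R).
Proof.
split=> [[? ?] [? ?]|[? ?]|[? ?] ?|[x y]|f F l []|I f []] //=.
  by rewrite mulr0 subr0.
by rewrite -sqrtr_sqr ler_wsqrtr// lerDl sqr_ge0.
Qed.

Lemma part_Im (R : realType) : part (@complex.Im R).
Proof.
split=> [[? ?] [? ?]|[? ?]|[? ?] ?|[x y]|f F l []|I f []] //=.
  by rewrite mulr0 add0r.
by rewrite -sqrtr_sqr ler_wsqrtr// lerDr sqr_ge0.
Qed.

Lemma col2_eq (K : nzRingType) (A : 'M[K]_2) (x y z w : K) :
  col2 x y = A *m col2 z w <->
  x = A 0 0 * z + A 0 1 * w /\ y = A 1 0 * z + A 1 1 * w.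
Proof.
have E i : (A *m col2 z w) i 0 = A i 0 * z + A i 1 * w.
  rewrite mxE !big_ord_recl big_ord0 addr0 !mxE/= (_ : lift _ _ = 1)//.
  exact/val_inj.
split=> [h|[hx hy]].
  by split; rewrite -E -h mxE.
apply/matrixP => i j; rewrite [j]ord1 E mxE.
by case: i => -[|[|//]] ilt /=; rewrite ?hx ?hy; congr (A _ _ * _ + A _ _ * _);
  apply/val_inj.
Qed.

Lemma sqr_normc (R : realType) (z : R[i]) :
  ComplexField.Normc.normc z ^+ 2 = complex.Re z ^+ 2 + complex.Im z ^+ 2.
Proof. by case: z => x y /=; rewrite sqr_sqrtr// addr_ge0 ?sqr_ge0. Qed.

(** The interface condition for the limits at [p] of a real function. *)
Definition interface (R : realType) (A : 'M[R]_2) (l l' r r' : R) : Prop :=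
  r = A 0 0 * l + A 0 1 * l' /\ r' = A 1 0 * l + A 1 1 * l'.

Section bridge.
Variables (R : realType) (a b p : R) (V : R -> R) (delta gamma E : R).
Variables (alpha rho theta : R).

Let mu := @lebesgue_measure R.

Lemma part_cderiv_in (P : R[i] -> R) I (f : R -> R[i]) x l : part P ->
  cderiv_in I f x l -> slope_cvg I (P \o f) x (P l).
Proof.
move=> hP /(part_ccvg hP); rewrite /slope_cvg; apply: cvg_trans.
rewrite [X in X @ _ `=>` _](_ : _ =
  P \o (fun y => (f y - f x) / (y - x)%:C)) //; apply/funext => y /=.
by rewrite -fmorphV (partM hP) (partD hP) (partN hP).
Qed.

Lemma part_abs_cont (P : R[i] -> R) c d (f : R -> R[i]) : part P ->
  abs_cont c d f -> ac c d (P \o f).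
Proof.
move=> hP acf e /acf[eta eta0 H]; exists eta => // n s t st tI /(H n s t st tI).
apply: le_lt_trans; apply: ler_sum => i _ /=.
by rewrite -(partN hP) -(partD hP) part_le.
Qed.

Lemma part_real_eigen (A : 'M[R]_2) (P : R[i] -> R) (f f' : R -> R[i]) : part P ->
  ~ {ae mu, forall x, `[a, b]%classic x -> P (f x) = 0} ->
  L2 `[a, b] f ->
  (forall x, (`[a, b] `\ p) x -> cderiv_in `[a, b] f x (f' x)) ->
  loc_abs_cont (`[a, b] `\ p) f -> loc_abs_cont (`[a, b] `\ p) f' ->
  is_tau `[a, b] V f f' (fun x => E%:C * f x) ->
  interface_cond p A f f' ->
  boundary_cond a delta f f' -> boundary_cond b gamma f f' ->
  exists u u' l l' r r',
    real_eigen a b p V delta gamma E u u' l l' r r' /\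
    interface A l l' r r'.
Proof.
move=> hP nz fL2 df acf acf' tauf [fl [fl' [fr [fr' [cl cl' cr cr']]]]].
move=> /col2_eq; rewrite !mxE => -[hr hr'] bca bcb.
have partM' x z : P (x%:C * z) = x * P z by rewrite mulrC (partM hP) mulrC.
have part0 : P 0 = 0 by have := partM hP 0 0; rewrite mul0r mulr0.
exists (P \o f), (P \o f'), (P fl), (P fl'), (P fr), (P fr'); split; last first.
  by split; rewrite ?hr ?hr' (partD hP) !partM'.
have [_ _ fint] := fL2.
split => //.
- exact: (part_L2 hP).
- apply: le_lt_trans fint; apply: ge0_le_integral => //.
  + by move=> x _; rewrite lee_fin sqr_ge0.
  + apply/measurable_EFinP/measurable_funX; exact: (part_L2 hP).
  + apply/measurable_EFinP.
    rewrite [X in measurable_fun _ X](funext (fun x => sqr_normc (f x))).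
    by have [mRe mIm _] := fL2; apply: measurable_funD; exact: measurable_funX.
  + move=> x _; rewrite lee_fin -real_normK ?num_real//.
    by apply: lerXn2r; rewrite ?nnegrE ?part_le// (le_trans _ (part_le hP _)).
- by move=> x /df; exact: part_cderiv_in.
- move=> c d cd cdab; split; apply: part_abs_cont => //.
    exact: acf.
  exact: acf'.
- move: tauf; apply: filterS.
    exact: (ae_filter_ringOfSetsType lebesgue_measure).
  move=> x H /H[f'' df'' eqx]; exists (P f''); first exact: part_cderiv_in.
  by rewrite /= -partM' eqx (partD hP) (partN hP) partM'.
- exact: (part_ccvg hP cl).
- exact: (part_ccvg hP cl').
- exact: (part_ccvg hP cr).
- exact: (part_ccvg hP cr').
- by rewrite /= -!(partM hP) -(partD hP) bca.
- by rewrite /= -!(partM hP) -(partD hP) bcb.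
Qed.

(** The real part and the imaginary part of an eigenfunction are not both zero
    almost everywhere, so one of them is a real eigenfunction. *)
Lemma sigma_pH_real_eigen :
  sigma_pH a b p V delta gamma alpha rho theta E%:C ->
  exists u u' l l' r r',
    real_eigen a b p V delta gamma E u u' l l' r r' /\
    interface (Amx alpha rho theta) l l' r r'.
Proof.
move=> [f nz [fL2 _ [f' [df [acf acf'] tauf ic [bca bcb]]]]].
have [re0|nre0] := pselect
    {ae mu, forall x, `[a, b]%classic x -> complex.Re (f x) = 0}; last first.
  by apply: (@part_real_eigen _ (@complex.Re R) f f') => //; exact: part_Re.
apply: (@part_real_eigen _ (@complex.Im R) f f') => //; first exact: part_Im.
move=> im0; apply: nz; move: re0 im0; apply: filterS2.
  exact: (ae_filter_ringOfSetsType lebesgue_measure).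
move=> x h1 h2 Ix; move: (h1 Ix) (h2 Ix).
by case: (f x) => ? ? /= -> ->.
Qed.

Lemma ccvg_real (u : R -> R) F (l : R) : Filter F ->
  u @ F --> l -> ccvg (fun x => (u x)%:C) F l%:C.
Proof. by move=> FF ul; split=> //=; exact: cvg_cst. Qed.

Lemma cderiv_in_real I (u : R -> R) x l :
  slope_cvg I u x l -> cderiv_in I (fun x => (u x)%:C) x l%:C.
Proof.
rewrite /cderiv_in; under eq_fun do rewrite -rmorphB -fmorphV -rmorphM.
exact: ccvg_real.
Qed.

Lemma normc_real (x : R) : ComplexField.Normc.normc x%:C = `|x|.
Proof. by rewrite /= expr0n addr0 sqrtr_sqr. Qed.

Lemma abs_cont_real c d (u : R -> R) :
  ac c d u -> abs_cont c d (fun x => (u x)%:C).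
Proof.
move=> acu e /acu[eta eta0 H]; exists eta => // n s t st tI /(H n s t st tI).
apply: le_lt_trans; apply: ler_sum => i _.
by rewrite -rmorphB le_eqVlt; apply/orP; left; apply/eqP; exact: normc_real.
Qed.

Lemma L2_real I (u : R -> R) : measurable_fun I u ->
  (\int[mu]_(x in I) ((u x) ^+ 2)%:E < +oo)%E -> L2 I (fun x => (u x)%:C).
Proof.
move=> mu_u intu; split => //.
by under eq_integral => x _ do rewrite normc_real real_normK ?num_real//.
Qed.

Lemma real_eigen_sigma_pH u u' l l' r r' :
  real_eigen a b p V delta gamma E u u' l l' r r' ->
  interface (Amx alpha rho theta) l l' r r' ->
  sigma_pH a b p V delta gamma alpha rho theta E%:C.
Proof.
move=> re [hr hr']; exists (fun x => (u x)%:C).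
  move=> h; apply: (re_neq0 re); move: h; apply: filterS.
    exact: (ae_filter_ringOfSetsType lebesgue_measure).
  by move=> x H /H[].
split.
- by apply: L2_real; [exact: re_meas re|exact: re_L2 re].
- rewrite [X in L2 _ X](_ : _ = fun x => (E * u x)%:C); last first.
    by apply/funext => x; exact/esym/rmorphM.
  apply: L2_real.
    by apply: measurable_funM => //; exact: re_meas re.
  under eq_integral do rewrite exprMn EFinM.
  rewrite ge0_integralZl//=.
  + by rewrite lte_mul_pinfty ?lee_fin ?sqr_ge0//; exact: re_L2 re.
  + by apply/measurable_EFinP/measurable_funX; exact: re_meas re.
  + by move=> x _; rewrite lee_fin sqr_ge0.
  + by rewrite lee_fin sqr_ge0.
exists (fun x => (u' x)%:C); split.
- by move=> x /(re_deriv re); exact: cderiv_in_real.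
- by split=> c d cd cdab; apply: abs_cont_real; have [] := re_ac re cd cdab.
- have := re_eq re; apply: filterS.
    exact: (ae_filter_ringOfSetsType lebesgue_measure).
  move=> x H /H[u'' du'' eqx]; exists u''%:C; first exact: cderiv_in_real.
  by rewrite -!rmorphM -rmorphN -rmorphD eqx.
- exists l%:C, l'%:C, r%:C, r'%:C; split.
  + exact: ccvg_real (re_lim_l re).
  + exact: ccvg_real (re_lim_l' re).
  + exact: ccvg_real (re_lim_r re).
  + exact: ccvg_real (re_lim_r' re).
  + move: (Amx _ _ _) hr hr' => A hr hr'; apply/col2_eq.
    by rewrite !mxE -!rmorphM -!rmorphD -hr -hr'.
- by split; rewrite /boundary_cond -!rmorphM -rmorphD ?(re_bc_a re) ?(re_bc_b re).
Qed.

End bridge.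

(** * Gluing and the eigenvalue criterion *)

(** The factor used to rescale a solution on the right side only: [1] to the
    left of [p] and [k] from [p] on. *)
Definition jump (R : realType) (p k x : R) : R := if x < p then 1 else k.

Lemma jump_near (R : realType) (p k x : R) : x <> p ->
  \forall y \near x, jump p k y = jump p k x.
Proof.
rewrite /jump => xp; have [xltp|px|/xp//] := ltgtP x p.
  near=> y; rewrite ifT//; near: y; exact: lt_nbhsl.
near=> y; rewrite ifF//; apply/negbTE; rewrite -leNgt ltW//; near: y.
exact: lt_nbhsr.
Unshelve. all: by end_near. Qed.

Lemma slope_cvg_jump (R : realType) (I : set R) (p k : R) (f : R -> R) (x l : R) :
  x <> p -> slope_cvg I f x l ->
  slope_cvg I (fun y => jump p k y * f y) x (jump p k x * l).
Proof.
move=> xp fl.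
have H : {near within I x^', (fun y => jump p k x * ((f y - f x) / (y - x)))
    =1 (fun y => (jump p k y * f y - jump p k x * f x) / (y - x))}.
  rewrite near_withinE.
  have : \forall y \near x^', jump p k y = jump p k x.
    by apply: nbhs_dnbhs; exact: jump_near.
  by apply: filterS => y -> _; rewrite mulrA mulrBr.
exact: cvg_trans (near_eq_cvg H) (cvgMl_tmp fl).
Qed.

Lemma ac_eqZ (R : realType) (c d k : R) (f g : R -> R) :
  (forall x, c <= x <= d -> g x = k * f x) -> ac c d f -> ac c d g.
Proof.
move=> gE acf; apply: (@ac_le2 _ _ _ `|k| f f) => // x y xcd ycd.
by rewrite !gE// -mulrBr normrM lerDl mulr_ge0.
Qed.

(** An eigenfunction stays one, for another interface condition, when its
    restriction to the right of [p] is rescaled. *)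
Lemma real_eigen_jump (R : realType) (a b p : R) (V : R -> R)
    (delta gamma E : R) (u u' : R -> R) (l l' r r' k : R) :
  a < p < b -> k != 0 ->
  real_eigen a b p V delta gamma E u u' l l' r r' ->
  real_eigen a b p V delta gamma E (fun x => jump p k x * u x)
    (fun x => jump p k x * u' x) l l' (k * r) (k * r').
Proof.
move=> /andP[ap pb] k0 re.
have jump0 x : jump p k x != 0 by rewrite /jump; case: ifP => // _; exact: oner_neq0.
have mj : measurable_fun `[a, b] (jump p k).
  apply: measurable_funTS; apply: measurable_fun_ifT => //.
  exact: measurable_fun_ltr.
have liml (f : R -> R) z : f @ p^'- --> z -> jump p k x * f x @[x --> p^'-] --> z.
  move=> fz; have H : {near p^'-, f =1 (fun x => jump p k x * f x)}.
    have := nbhs_left_lt p; apply: filterS => x xp.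
    by rewrite /jump xp mul1r.
  exact: cvg_trans (near_eq_cvg H) fz.
have limr (f : R -> R) z : f @ p^'+ --> z ->
    jump p k x * f x @[x --> p^'+] --> k * z.
  move=> fz; have H : {near p^'+, (fun x => k * f x) =1
      (fun x => jump p k x * f x)}.
    have := nbhs_right_gt p; apply: filterS => x px.
    by rewrite /jump ltNge (ltW px).
  exact: cvg_trans (near_eq_cvg H) (cvgMl_tmp fz).
split.
- move=> h; apply: (re_neq0 re); move: h; apply: filterS.
    exact: (ae_filter_ringOfSetsType lebesgue_measure).
  by move=> x H /H /eqP; rewrite mulf_eq0 (negbTE (jump0 x)) => /eqP.
- by apply: measurable_funM => //; exact: re_meas re.
- have mu2 : measurable_fun `[a, b] (fun x => (u x) ^+ 2).
    by apply: measurable_funX; exact: re_meas re.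
  have lty : (\int[@lebesgue_measure R]_(x in `[a, b])
      ((1 + k ^+ 2)%:E * ((u x) ^+ 2)%:E) < +oo)%E.
    rewrite ge0_integralZl//=.
    + rewrite lte_mul_pinfty ?lee_fin ?addr_ge0 ?sqr_ge0//; exact: re_L2 re.
    + exact/measurable_EFinP.
    + by move=> x _; rewrite lee_fin sqr_ge0.
    + by rewrite lee_fin addr_ge0 ?sqr_ge0.
  apply: le_lt_trans lty; apply: ge0_le_integral => //.
  + by move=> x _; rewrite lee_fin sqr_ge0.
  + apply/measurable_EFinP/measurable_funX/measurable_funM => //.
    exact: re_meas re.
  + by apply: emeasurable_funM => //; exact/measurable_EFinP.
  + move=> x _; rewrite -EFinM lee_fin exprMn ler_wpM2r ?sqr_ge0//.
    by rewrite /jump; case: ifP => _; rewrite ?expr1n ?lerDl ?lerDr ?sqr_ge0.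
- by move=> x [xab xp]; apply: slope_cvg_jump => //; exact: re_deriv re _ _.
- move=> c d cd cdab; have [acu acu'] := re_ac re cd cdab.
  have jE : exists j, forall x, c <= x <= d -> jump p k x = j.
    have [dp|pd] := ltP d p.
      by exists 1 => x /andP[_ xd]; rewrite /jump ifT// (le_lt_trans xd).
    have pc : p < c.
      rewrite ltNge; apply/negP => cp.
      have /cdab[_] : `[c, d]%classic p by rewrite /= in_itv/= cp.
      exact.
    exists k => x /andP[cx _]; rewrite /jump ifF//; apply/negbTE.
    by rewrite -leNgt ltW// (lt_le_trans pc).
  have [j hj] := jE.
  by split; [apply: ac_eqZ acu|apply: ac_eqZ acu'] => x xcd; rewrite hj.
- have aep : {ae @lebesgue_measure R, forall x, x <> p}.
    exists [set p]; split => //; first exact: lebesgue_measure_set1.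
    by move=> x /= /contrapT.
  move: (re_eq re) aep; apply: filterS2.
    exact: (ae_filter_ringOfSetsType lebesgue_measure).
  move=> x H xp /H[u'' du'' eqx]; exists (jump p k x * u'').
    exact: slope_cvg_jump.
  by rewrite mulrCA eqx; ring.
- exact: liml (re_lim_l re).
- exact: liml (re_lim_l' re).
- exact: limr (re_lim_r re).
- exact: limr (re_lim_r' re).
- by rewrite -!mulrA -mulrDr (re_bc_a re) mulr0.
- by rewrite -!mulrA -mulrDr (re_bc_b re) mulr0.
Qed.

(** The components of [A_(alpha, rho, theta) (l, l')]. *)
Definition Afst (R : realType) (alpha rho theta l l' : R) : R :=
  rho * (cos theta * l - sin theta * l') +
  alpha / rho * (sin theta * l + cos theta * l').
Definition Asnd (R : realType) (rho theta l l' : R) : R :=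
  (sin theta * l + cos theta * l') / rho.

Lemma interfaceE (R : realType) (alpha rho theta l l' r r' : R) :
  interface (Amx alpha rho theta) l l' r r' <->
  r = Afst alpha rho theta l l' /\ r' = Asnd rho theta l l'.
Proof.
have E1 i j : Amx alpha rho theta i j =
    (Pmx alpha i 0 * (Hmx rho 0 0 * Emx theta 0 j + Hmx rho 0 1 * Emx theta 1 j) +
     Pmx alpha i 1 * (Hmx rho 1 0 * Emx theta 0 j + Hmx rho 1 1 * Emx theta 1 j)).
  have one : lift ord0 ord0 = 1 :> 'I_2 by apply/val_inj.
  rewrite /Amx mxE !big_ord_recl big_ord0 addr0 !one.
  rewrite ![(_ *m _) _ _]mxE !big_ord_recl !big_ord0 !addr0 !one.
  ring.
rewrite /interface !E1 !mxE /= /Afst /Asnd.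
by split=> -[-> ->]; split; ring.
Qed.

(** The map [A_(alpha, rho, theta)] is injective. *)
Lemma A_eq0 (R : realType) (alpha rho theta l l' : R) : 0 < rho ->
  Afst alpha rho theta l l' = 0 -> Asnd rho theta l l' = 0 ->
  l = 0 /\ l' = 0.
Proof.
move=> rho0 h1 h2.
have w2 : sin theta * l + cos theta * l' = 0.
  by move: h2 => /eqP; rewrite /Asnd mulf_eq0 invr_eq0 (gt_eqF rho0) orbF => /eqP.
have w1 : cos theta * l - sin theta * l' = 0.
  move: h1 => /eqP; rewrite /Afst w2 mulr0 addr0 mulf_eq0 (gt_eqF rho0).
  by move=> /eqP.
have cs := cos2Dsin2 theta.
have h : l ^+ 2 + l' ^+ 2 = 0.
  rewrite -[LHS]mul1r -cs.
  have -> : (cos theta ^+ 2 + sin theta ^+ 2) * (l ^+ 2 + l' ^+ 2) =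
    (sin theta * l + cos theta * l') ^+ 2 + (cos theta * l - sin theta * l') ^+ 2.
    by ring.
  by rewrite w1 w2 expr0n addr0.
move/eqP: h; rewrite paddr_eq0 ?sqr_ge0// !sqrf_eq0 => /andP[/eqP ? /eqP ?].
by [].
Qed.

Lemma collinear (R : realType) (x y z w : R) :
  (x, y) <> (0, 0) -> x * w = y * z -> exists k, z = k * x /\ w = k * y.
Proof.
move=> xy0 h; have [x0|x0] := eqVneq x 0.
  have y0 : y != 0 by apply/eqP => y0; apply: xy0; rewrite x0 y0.
  exists (w / y); rewrite divfK// x0 mulr0; split=> //.
  by move: h => /eqP; rewrite x0 mul0r eq_sym mulf_eq0 (negbTE y0) => /eqP.
exists (z / x); rewrite divfK//; split=> //.
by apply: (mulfI x0); rewrite h; field.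
Qed.

(** If [E] is an eigenvalue for one interface condition, it is one for another
    exactly when both conditions send the boundary values at [p] from the left
    to collinear vectors. *)
Lemma sigma_pH_criterion (R : realType) (a b p : R) (V : R -> R)
    (delta gamma E alpha rho theta : R) :
  a < p < b ->
  (@lebesgue_measure R).-integrable `[a, b] (EFin \o V) -> 0 < rho ->
  sigma_pH a b p V delta gamma alpha rho theta E%:C ->
  exists l l', (l, l') <> (0, 0) /\
    forall alpha' rho' theta', 0 < rho' ->
      sigma_pH a b p V delta gamma alpha' rho' theta' E%:C <->
      Afst alpha rho theta l l' * Asnd rho' theta' l l' =
      Asnd rho theta l l' * Afst alpha' rho' theta' l l'.
Proof.
move=> apb intV rho0 /sigma_pH_real_eigen[u [u' [l [l' [r [r' [re]]]]]]].
move=> /interfaceE[hr hr'].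
have ll0 : (l, l') <> (0, 0).
  move=> [l0 l'0]; apply: (real_eigen_lim_neq0 apb intV re).
  by rewrite hr hr' /Afst /Asnd l0 l'0; split=> //; ring.
have A0 alpha' rho' theta' : 0 < rho' ->
    (Afst alpha' rho' theta' l l', Asnd rho' theta' l l') <> (0, 0).
  by move=> rho'0 [h1 h2]; apply: ll0; have [-> ->] := A_eq0 rho'0 h1 h2.
exists l, l'; split=> // alpha' rho' theta' rho'0; split.
  move=> /sigma_pH_real_eigen[v [v' [m [m' [s [s' [rv]]]]]]].
  move=> /interfaceE[hs hs'].
  have := real_eigen_wronskian_right apb re rv.
  (* [v] has, to the left of [p], the same limits as [u] up to a factor. *)
  have [k [mE m'E]] := collinear ll0 (real_eigen_wronskian_left apb re rv).
  have k0 : k != 0.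
    apply/eqP => k0; apply: (real_eigen_lim_neq0 apb intV rv).
    by rewrite hs hs' mE m'E k0 /Afst /Asnd; split=> //; ring.
  rewrite hr hr' hs hs' mE m'E => h; apply: (mulfI k0).
  have e1 : Asnd rho' theta' (k * l) (k * l') = k * Asnd rho' theta' l l'.
    by rewrite /Asnd; ring.
  have e2 : Afst alpha' rho' theta' (k * l) (k * l') =
      k * Afst alpha' rho' theta' l l' by rewrite /Afst; ring.
  by move: h; rewrite e1 e2 !(mulrCA _ k).
rewrite -hr -hr' => h.
have rr0 : (r, r') <> (0, 0) by rewrite hr hr'; exact: A0.
have [k [k1 k2]] := collinear rr0 h.
have k0 : k != 0.
  apply/eqP => k0; apply: (A0 alpha' _ theta' rho'0).
  by rewrite k1 k2 k0 !mul0r.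
apply: (real_eigen_sigma_pH (real_eigen_jump apb k0 re)).
by apply/interfaceE; rewrite -k1 -k2.
Qed.

(** * Dependence on each of the parameters *)

Lemma sin_nat_pi (R : realType) (n : nat) : sin (n%:R * pi) = 0 :> R.
Proof.
elim: n => [|n IH]; first by rewrite mul0r sin0.
by rewrite -natr1 mulrDl mul1r sinDpi IH oppr0.
Qed.

Lemma sin_int_pi (R : realType) (k : int) : sin (k%:~R * pi) = 0 :> R.
Proof.
case: k => n; first exact: sin_nat_pi.
by rewrite NegzE mulrNz mulNr sinN sin_nat_pi oppr0.
Qed.

Lemma sin_eq0 (R : realType) (x : R) :
  sin x = 0 <-> exists k : int, x = k%:~R * pi.
Proof.
split=> [sx|[k ->]]; last exact: sin_int_pi.
pose k := Num.floor (x / pi).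
have pi0 := pi_gt0 R.
have kx : k%:~R <= x / pi by exact: floor_le.
have xk : x / pi < (k + 1)%:~R by exact: floorD1_gt.
exists k; apply/eqP; rewrite -subr_eq0; set y := x - _.
have sy : sin y = 0 by rewrite sinB sx sin_int_pi mul0r mulr0 subrr.
have y0 : 0 <= y by rewrite subr_ge0 -ler_pdivlMr.
have ypi : y < pi.
  by rewrite ltrBlDr -[X in X + _]mul1r -mulrDl -ltr_pdivrMr// addrC -intrD1.
apply/negPn/negP => yn0.
have : 0 < sin y by apply: sin_gt0_pi; rewrite lt_neqAle eq_sym yn0 y0.
by rewrite sy ltxx.
Qed.

(** The determinant of [A_(alpha, rho, theta) (l, l')] and
    [A_(alpha', rho', theta') (l, l')]. *)
Definition Adet (R : realType) (l l' alpha rho theta alpha' rho' theta' : R) :=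
  Afst alpha rho theta l l' * Asnd rho' theta' l l' -
  Asnd rho theta l l' * Afst alpha' rho' theta' l l'.

Lemma Adet_theta (R : realType) (l l' alpha rho theta theta' : R) : rho != 0 ->
  Adet l l' alpha rho theta alpha rho theta' =
  (l ^+ 2 + l' ^+ 2) * sin (theta' - theta).
Proof. by move=> rho0; rewrite /Adet /Afst /Asnd sinB; field. Qed.

Lemma Adet_rho (R : realType) (l l' alpha rho theta rho' : R) :
  rho != 0 -> rho' != 0 ->
  Adet l l' alpha rho theta alpha rho' theta =
  (cos theta * l - sin theta * l') * (sin theta * l + cos theta * l') *
  ((rho - rho') * (rho + rho') / (rho * rho')).
Proof.
by move=> rho0 rho'0; rewrite /Adet /Afst /Asnd; field; rewrite rho0 rho'0.
Qed.

Lemma Adet_alpha (R : realType) (l l' alpha rho theta alpha' : R) : rho != 0 ->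
  Adet l l' alpha rho theta alpha' rho theta =
  (alpha - alpha') * ((sin theta * l + cos theta * l') / rho) ^+ 2.
Proof. by move=> rho0; rewrite /Adet /Afst /Asnd; field. Qed.

Theorem theorem4p1 (R : realType) (a b p : R) (V : R -> R) (delta gamma : R)
    (hp : a < p < b)
    (hV : (@lebesgue_measure R).-integrable `[a, b] (EFin \o V))
    (hdelta : 0 <= delta < pi) (hgamma : 0 <= gamma < pi)
    (alpha r theta E : R) (hr : 0 < r)
    (hE : sigma_pH a b p V delta gamma alpha r theta E%:C) :
  [/\ forall theta' : R,
        sigma_pH a b p V delta gamma alpha r theta' E%:C <->
        exists k : int, theta' = theta + k%:~R * pi,
      (forall r' : R, 0 < r' -> r' <> r ->
         ~ sigma_pH a b p V delta gamma alpha r' theta E%:C) \/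
      (forall r' : R, 0 < r' ->
         sigma_pH a b p V delta gamma alpha r' theta E%:C) &
      (forall alpha' : R, alpha' <> alpha ->
         ~ sigma_pH a b p V delta gamma alpha' r theta E%:C) \/
      (forall alpha' : R,
         sigma_pH a b p V delta gamma alpha' r theta E%:C)].
Proof.
have [l [l' [ll0 crit]]] := sigma_pH_criterion hp hV hr hE.
have {}crit alpha' r' theta' : 0 < r' ->
    sigma_pH a b p V delta gamma alpha' r' theta' E%:C <->
    Adet l l' alpha r theta alpha' r' theta' = 0.
  move=> r'0; split=> [/(crit _ _ _ r'0) h|/eqP h].
    by apply/eqP; rewrite subr_eq0 h.
  by apply/(crit _ _ _ r'0)/eqP; rewrite -subr_eq0.
have r_neq0 : r != 0 by rewrite gt_eqF.
pose w1 := cos theta * l - sin theta * l'.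
pose w2 := sin theta * l + cos theta * l'.
split.
- move=> theta'.
  have n0 : l ^+ 2 + l' ^+ 2 != 0.
    rewrite paddr_eq0 ?sqr_ge0// !sqrf_eq0; apply/negP => /andP[/eqP l0 /eqP l'0].
    by apply: ll0; rewrite l0 l'0.
  apply: (iff_trans (crit alpha r theta' hr)); rewrite Adet_theta//.
  have sinE : (l ^+ 2 + l' ^+ 2) * sin (theta' - theta) = 0 <->
      sin (theta' - theta) = 0.
    split=> [/eqP|->]; last by rewrite mulr0.
    by rewrite mulf_eq0 (negbTE n0) => /eqP.
  apply: (iff_trans sinE); apply: (iff_trans (sin_eq0 _)).
  split=> -[k hk]; exists k; first by rewrite -hk addrC subrK.
  by rewrite hk addrC addKr.
- have [w0|w0] := eqVneq (w1 * w2) 0; [right|left] => r' r'0.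
    by apply/crit => //; rewrite Adet_rho ?(gt_eqF r'0)// -/w1 -/w2 w0 mul0r.
  move=> r'r /(crit _ _ _ r'0)/eqP; apply/negP.
  have s0 : r + r' != 0 by rewrite gt_eqF// addr_gt0.
  have d0 : r - r' != 0 by rewrite subr_eq0; exact/eqP/nesym.
  have r'_neq0 : r' != 0 by rewrite gt_eqF.
  have m0 : r * r' != 0 by exact: mulf_neq0.
  rewrite Adet_rho// -/w1 -/w2; apply: mulf_neq0 => //.
  by apply: mulf_neq0; [exact: mulf_neq0|rewrite invr_neq0].
- have [w0|w0] := eqVneq w2 0; [right|left] => alpha'.
    by apply/crit => //; rewrite Adet_alpha// -/w2 w0 mul0r expr0n mulr0.
  move=> alpha'alpha /(crit _ _ _ hr)/eqP; apply/negP.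
  have d0 : alpha - alpha' != 0 by rewrite subr_eq0; exact/eqP/nesym.
  rewrite Adet_alpha// -/w2; apply: mulf_neq0 => //; apply: expf_neq0.
  by apply: mulf_neq0 => //; rewrite invr_neq0.
Qed.
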